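(* Let $A\in\mathbb{R}^{n\times n}$ be symmetric positive definite and partitioned as $$A=\begin{pmatrix} A_{\rm ff} & A_{\rm fc} \\ A_{\rm cf} & A_{\rm cc} \end{pmatrix},$$ where $A_{\rm ff}\in\mathbb{R}^{n_{\rm f}\times n_{\rm f}}$, $A_{\rm fc}\in\mathbb{R}^{n_{\rm f}\times n_{\rm c}}$, $A_{\rm cf}=A_{\rm fc}^{T}$, $A_{\rm cc}\in\mathbb{R}^{n_{\rm c}\times n_{\rm c}}$, $n_{\rm f}+n_{\rm c}=n$. Let $D_{\rm ff}\in\mathbb{R}^{n_{\rm f}\times n_{\rm f}}$ be a symmetric positive definite matrix such that $$A_{\rm ff}\succeq D_{\rm ff}\succeq\frac{1}{1+\varepsilon}A_{\rm ff}\quad\text{and}\quad\begin{pmatrix} D_{\rm ff} & A_{\rm fc} \\ A_{\rm cf} & A_{\rm cc} \end{pmatrix}\succeq 0,$$ where $\varepsilon>0$ is a parameter. Take $$S=\begin{pmatrix} I_{n_{\rm f}} \\ 0 \end{pmatrix},\quad M_{\rm s}=\omega D_{\rm ff},\quad P=\begin{pmatrix} -D_{\rm ff}^{-1}A_{\rm fc} \\ I_{n_{\rm c}} \end{pmatrix},$$ where $\omega>\frac{1}{2}(1+\varepsilon)$. Then the convergence factor of the two-level method satisfies $$\|E_{\rm TL}\|_{A}\leq 1-\omega^{-2}(2\omega-1-\varepsilon).\qquad(1)$$ More generally, if the pre- and postsmoothing steps of the two-level method are carried out $\nu$ times iteratively ($\nu\geq 1$ an integer), then $$\|E_{\rm TL}\|_{A}\leq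 1-\frac{1-\big(1-\omega^{-1}(1+\varepsilon)\big)^{2\nu}}{1+\varepsilon}.\qquad(2)$$ Moreover, the upper bounds in (1) and (2), as functions of $\omega>\frac12(1+\varepsilon)$, attain the minimum $\frac{\varepsilon}{1+\varepsilon}$ if and only if $\omega=1+\varepsilon$.
   Context: For real symmetric matrices of the same order, $S_{1}\succeq S_{2}$ means $S_{1}-S_{2}$ is positive semidefinite. For the symmetric positive definite matrix $A$, $\|\mathbf{v}\|_{A}=\sqrt{\mathbf{v}^{T}A\mathbf{v}}$ and $\|B\|_{A}=\max_{\mathbf{v}\neq 0}\|B\mathbf{v}\|_{A}/\|\mathbf{v}\|_{A}$. Given $S$, $M_{\rm s}$ and $P$ (of full column rank), let $\Pi_{A}=P(P^{T}AP)^{-1}P^{T}A$. The two-level method for $A\mathbf{u}=\mathbf{f}$ consists of presmoothing $\mathbf{u}\leftarrow\mathbf{u}+SM_{\rm s}^{-1}S^{T}(\mathbf{f}-A\mathbf{u})$, coarse-level correction $\mathbf{u}\leftarrow\mathbf{u}+P(P^{T}AP)^{-1}P^{T}(\mathbf{f}-A\mathbf{u})$, and postsmoothing $\mathbf{u}\leftarrow\mathbf{u}+SM_{\rm s}^{-T}S^{T}(\mathbf{f}-A\mathbf{u})$. Its iteration (error propagation) matrix is $E_{\rm TL}=\big(I-SM_{\rm s}^{-T}S^{T}A\big)(I-\Pi_{A})\big(I-SM_{\rm s}^{-1}S^{T}A\big)$, and when the pre- and postsmoothing steps are each carried out $\nu$ times it is $E_{\rm TL}=\big(I-SM_{\rm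 s}^{-T}S^{T}A\big)^{\nu}(I-\Pi_{A})\big(I-SM_{\rm s}^{-1}S^{T}A\big)^{\nu}$. The convergence factor is $\|E_{\rm TL}\|_{A}$. *)

(* Defs.v *)
From HB Require Import structures.
From mathcomp Require Import all_boot all_order all_algebra.
From mathcomp Require Import all_classical all_reals all_analysis.
Set Implicit Arguments.
Unset Strict Implicit.
Unset Printing Implicit Defensive.
Import Order.TTheory GRing.Theory Num.Theory.
Import numFieldNormedType.Exports.
Local Open Scope classical_set_scope.
Local Open Scope ring_scope.

Definition qform (R : realType) (n : nat) (A : 'M[R]_n) (v : 'cV[R]_n) : R :=
  (v^T *m A *m v) 0 0.

Definition posdefmx (R : realType) (n : nat) (A : 'M[R]_n) : Prop :=
  A^T = A /\ forall v : 'cV[R]_n, v != 0 -> 0 < qform A v.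

Definition possemidefmx (R : realType) (n : nat) (A : 'M[R]_n) : Prop :=
  A^T = A /\ forall v : 'cV[R]_n, 0 <= qform A v.

Definition loewner_ge (R : realType) (n : nat) (S1 S2 : 'M[R]_n) : Prop :=
  possemidefmx (S1 - S2).

Definition normA (R : realType) (n : nat) (A : 'M[R]_n) (v : 'cV[R]_n) : R :=
  Num.sqrt (qform A v).

(* The maximum over nonzero vectors is written as a supremum; the lemma
   [opnormA_max] below shows that it is attained as soon as [0 < n].  For
   [n = 0] there is no nonzero vector and the value is [0]. *)
Definition opnormA (R : realType) (n : nat) (A B : 'M[R]_n) : R :=
  sup [set normA A (B *m v) / normA A v | v in [set v : 'cV[R]_n | v != 0]].

Definition projA (R : realType) (n k : nat) (A : 'M[R]_n) (P : 'M[R]_(n, k)) :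
    'M[R]_n :=
  P *m invmx (P^T *m A *m P) *m P^T *m A.

(* Iteration matrix with [nu] pre- and [nu] postsmoothing steps; the plain
   two-level method is [nu = 1].  The inverses of [Ms] and [P^T *m A *m P] are
   the genuine ones only when these matrices are invertible. *)
Definition ETL (R : realType) (n m k : nat) (A : 'M[R]_n) (S : 'M[R]_(n, m))
    (Ms : 'M[R]_m) (P : 'M[R]_(n, k)) (nu : nat) : 'M[R]_n :=
  (1%:M - S *m (invmx Ms)^T *m S^T *m A) ^+ nu
    *m (1%:M - projA A P)
    *m (1%:M - S *m invmx Ms *m S^T *m A) ^+ nu.

Definition bound1 (R : realType) (eps omega : R) : R :=
  1 - omega ^- 2 * (2 * omega - 1 - eps).

Definition bound2 (R : realType) (eps : R) (nu : nat) (omega : R) : R :=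
  1 - (1 - (1 - omega^-1 * (1 + eps)) ^+ (2 * nu)) / (1 + eps).

(* [f] attains its minimum over the set [D] at [x], with minimal value [m]. *)
Definition attains_min (R : realType) (f : R -> R) (D : set R) (m x : R) : Prop :=
  [/\ D x, f x = m & forall y, D y -> m <= f y].

Section OpnormMax.
Variables (R : realType).

Lemma qformE (n : nat) (A : 'M[R]_n) (v : 'cV[R]_n) :
  qform A v = \sum_j (\sum_i v i 0 * A i j) * v j 0.
Proof.
rewrite /qform mxE; apply: eq_bigr => j _; rewrite mxE; congr (_ * _).
by apply: eq_bigr => i _; rewrite mxE.
Qed.

Lemma qformZ (n : nat) (A : 'M[R]_n) (a : R) (v : 'cV[R]_n) :
  qform A (a *: v) = a ^+ 2 * qform A v.
Proof.
by rewrite /qform [(a *: v)^T]linearZ /= -scalemxAr -!scalemxAl scalerA mxE expr2.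
Qed.

Lemma normAZ (n : nat) (A : 'M[R]_n) (a : R) (v : 'cV[R]_n) :
  normA A (a *: v) = `|a| * normA A v.
Proof. by rewrite /normA qformZ sqrtrM ?sqr_ge0// sqrtr_sqr. Qed.

Lemma normA_gt0 (n : nat) (A : 'M[R]_n) (v : 'cV[R]_n) :
  posdefmx A -> v != 0 -> 0 < normA A v.
Proof. by case=> _ hA v0; rewrite /normA sqrtr_gt0 hA. Qed.

Lemma continuous_normA_tr (n : nat) (A B : 'M[R]_n) :
  continuous (fun x : 'rV[R]_n => normA A (B *m x^T)).
Proof.
have csum (m : nat) (F : 'I_m -> 'rV[R]_n -> R) :
    (forall i, continuous (F i)) -> continuous (fun y => \sum_i F i y).
  move=> hF; apply: (continuous_big (op := +%R)) => // z.
  by apply: cvgD; [exact: cvg_fst | exact: cvg_snd].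
have cmul (f g : 'rV[R]_n -> R) :
    continuous f -> continuous g -> continuous (fun y => f y * g y).
  by move=> hf hg y; apply: continuousM; [exact: hf | exact: hg].
have ccst (a : R) : continuous (fun _ : 'rV[R]_n => a).
  by move=> y; exact: cst_continuous.
have hB i : continuous (fun y : 'rV[R]_n => (B *m y^T) i 0).
  rewrite (_ : (fun y : 'rV[R]_n => _) = fun y => \sum_j B i j * y 0 j).
    by apply: (csum) => j; apply: (cmul) => //; exact: coord_continuous.
  by apply/funext => y; rewrite mxE; apply: eq_bigr => j _; rewrite mxE.
have hq : continuous (fun y : 'rV[R]_n => qform A (B *m y^T)).
  rewrite (_ : (fun y : 'rV[R]_n => _) = fun y =>
    \sum_j (\sum_i (B *m y^T) i 0 * A i j) * (B *m y^T) j 0).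
    by apply: (csum) => j; apply: (cmul) => //; apply: (csum) => i; exact: cmul.
  by apply/funext => y; rewrite qformE.
move=> x; apply: (continuous_comp (f := fun y : 'rV[R]_n => qform A (B *m y^T))
  (g := @Num.sqrt R)); [exact: hq | exact: sqrt_continuous].
Qed.

Lemma opnormA_max (n : nat) (A B : 'M[R]_n) : (0 < n)%N -> posdefmx A ->
  exists v : 'cV[R]_n, [/\ v != 0, opnormA A B = normA A (B *m v) / normA A v &
    forall w : 'cV[R]_n, w != 0 ->
      normA A (B *m w) / normA A w <= normA A (B *m v) / normA A v].
Proof.
move=> n0 hA.
pose f (x : 'rV[R]_n) := normA A (B *m x^T) / normA A x^T.
pose K := [set x : 'rV[R]_n | `|x| = 1].
have K0 x : K x -> x^T != 0.
  move=> Kx; apply/eqP => /(congr1 trmx); rewrite trmxK trmx0 => x0.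
  by move: Kx; rewrite /K /= x0 normr0 => /esym/eqP; rewrite oner_eq0.
have Kne : K !=set0.
  pose e : 'rV[R]_n := const_mx 1.
  have e0 : e != 0.
    apply/eqP => /matrixP /(_ 0 (Ordinal n0)); rewrite !mxE => /eqP.
    by rewrite oner_eq0.
  exists (`|e|^-1 *: e); rewrite /K /= normrZ normfV normr_id mulVf//.
  by rewrite normr_eq0.
have Kc : compact K.
  apply: bounded_closed_compact.
    by exists 1; split; [exact: real1 | move=> M M1 x /= ->; exact: ltW].
  have -> : K = (fun x : 'rV[R]_n => `|x|) @^-1` [set 1] by [].
  apply: closed_comp; last exact: closed_eq.
  by move=> x _; exact: norm_continuous.
have fc : {within K, continuous f}.
  apply: continuous_in_subspaceT => x /set_mem Kx.
  have hN : {for x, continuous (fun y : 'rV[R]_n => normA A y^T)}.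
    have := @continuous_normA_tr n A 1%:M x.
    by rewrite (_ : (fun y : 'rV[R]_n => _) = fun y => normA A y^T)//;
      apply/funext => y; rewrite mul1mx.
  have nx : normA A x^T != 0 by rewrite gt_eqF// normA_gt0// K0.
  pose g (y : 'rV[R]_n) := normA A y^T.
  have hV := continuousV (s := g) nx hN.
  exact: (continuousM (@continuous_normA_tr n A B x) hV).
have [c /set_mem Kc0 cmax] := EVT_max_rV Kne Kc fc.
have hmax (w : 'cV[R]_n) : w != 0 ->
    normA A (B *m w) / normA A w <= normA A (B *m c^T) / normA A c^T.
  move=> w0.
  have wT0 : w^T != 0.
    by apply: contra_neq w0 => /(congr1 trmx); rewrite trmxK trmx0.
  have nw : `|w^T| != 0 by rewrite normr_eq0.
  have Kw : (`|w^T|^-1 *: w^T) \in K.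
    by apply/mem_set; rewrite /K /= normrZ normfV normr_id mulVf.
  have := cmax _ Kw.
  rewrite /f [(_ *: _)^T]linearZ /= trmxK -scalemxAr !normAZ invfM mulrACA divff ?mul1r//.
  by rewrite normr_eq0 invr_eq0.
exists c^T; split => //; first exact: K0.
pose E := [set normA A (B *m v) / normA A v | v in [set v : 'cV[R]_n | v != 0]].
have Eub : ubound E (normA A (B *m c^T) / normA A c^T).
  by move=> _ [w /= w0 <-]; exact: hmax.
have Ec : E (normA A (B *m c^T) / normA A c^T) by exists c^T => //; exact: K0.
apply/eqP; rewrite eq_le; apply/andP; split.
  by apply: ge_sup => //; eexists; exact: Ec.
by apply: ub_le_sup => //; eexists; exact: Eub.
Qed.

End OpnormMax.

(* Main.v *)
Require Import Defs.
From HB Require Import structures.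
From mathcomp Require Import all_boot all_order all_algebra.
From mathcomp Require Import all_classical all_reals all_analysis.
From mathcomp Require Import ring lra.
Set Implicit Arguments.
Unset Strict Implicit.
Unset Printing Implicit Defensive.
Import Order.TTheory GRing.Theory Num.Theory.
Import numFieldNormedType.Exports.
Local Open Scope classical_set_scope.
Local Open Scope ring_scope.

(** The proof works in the inner product [dotmx A] and never diagonalizes.

    Since [Dff] is symmetric, pre- and postsmoothing share the matrix
    [G = 1 - omega^-1 B] with [B = S Dff^-1 S^T A], which is self-adjoint for
    [A].  The A-orthogonal projection [Q = 1 - projA A P] is self-adjoint as
    well, so the iteration matrix is [G^nu Q G^nu = (Q G^nu)^* (Q G^nu)], and
    its norm is the best constant [b] with |G^nu u|^2 <= b |u|^2 on the range of
    [Q], that is, for [P^T A u = 0] ([symmetric_two_level_bound]).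

    Two estimates on [B] carry the argument.  From [Aff <= (1 + eps) Dff] one
    gets <Bv, v> <= (1 + eps) <v, v> for every [v] ([dotmx_le_of_upper_bound]),
    hence mu <= G <= 1 with [mu = 1 - omega^-1 (1 + eps)].  In the other
    direction, replacing [Aff] by [Dff] in [A] gives a semidefinite minorant of
    [A] for which [P] is the exact harmonic extension, and this yields
    <u, u> <= <Bu, u> as soon as [P^T A u = 0] ([qform_le_of_minorant]).

    The function x^(2 nu) is convex, so on [mu, 1] it lies below its chord, and
    the same holds for [G]:
      |G^nu u|^2 <= |u|^2 - (1 - mu^(2 nu)) / (1 - mu) <(1 - G) u, u>
    ([geometric_decay]).  Inserting <(1 - G) u, u> = omega^-1 <Bu, u>
    >= omega^-1 |u|^2 gives bound (2), and bound (1) is its case [nu = 1].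

    Finally the bound equals
      eps / (1 + eps) + (1 - omega^-1 (1 + eps))^(2 nu) / (1 + eps),
    whose second term is a positive multiple of an even power, zero only at
    [omega = 1 + eps]. *)

(** * The bilinear form of a matrix *)

Definition dotmx (R : realType) (n : nat) (A : 'M[R]_n) (u v : 'cV[R]_n) : R :=
  (u^T *m A *m v) 0 0.

Lemma qform_dotmx (R : realType) (n : nat) (A : 'M[R]_n) (v : 'cV[R]_n) :
  qform A v = dotmx A v v.
Proof. by []. Qed.

Lemma dotmxC (R : realType) (n : nat) (A : 'M[R]_n) (u v : 'cV[R]_n) :
  A^T = A -> dotmx A u v = dotmx A v u.
Proof.
move=> sA; rewrite /dotmx -[u^T *m A *m v]trmxK [LHS]mxE.
by rewrite !trmx_mul trmxK sA mulmxA.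
Qed.

Lemma dotmxBr (R : realType) (n : nat) (A : 'M[R]_n) (u v w : 'cV[R]_n) :
  dotmx A u (v - w) = dotmx A u v - dotmx A u w.
Proof. by rewrite /dotmx mulmxBr !mxE. Qed.

Lemma dotmxZr (R : realType) (n : nat) (A : 'M[R]_n) (a : R) (u v : 'cV[R]_n) :
  dotmx A u (a *: v) = a * dotmx A u v.
Proof. by rewrite /dotmx -scalemxAr mxE. Qed.

Lemma dotmxBl (R : realType) (n : nat) (A : 'M[R]_n) (u v w : 'cV[R]_n) :
  dotmx A (u - v) w = dotmx A u w - dotmx A v w.
Proof. by rewrite /dotmx linearB /= !mulmxBl !mxE. Qed.

Lemma dotmxZl (R : realType) (n : nat) (A : 'M[R]_n) (a : R) (u v : 'cV[R]_n) :
  dotmx A (a *: u) v = a * dotmx A u v.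
Proof. by rewrite /dotmx linearZ /= -!scalemxAl mxE. Qed.

Lemma qformB (R : realType) (n : nat) (A : 'M[R]_n) (u v : 'cV[R]_n) :
  A^T = A -> qform A (u - v) = qform A u - 2 * dotmx A u v + qform A v.
Proof.
move=> sA; rewrite !qform_dotmx dotmxBr !dotmxBl (dotmxC v u sA); ring.
Qed.

Lemma qformBmx (R : realType) (n : nat) (A B : 'M[R]_n) (v : 'cV[R]_n) :
  qform (A - B) v = qform A v - qform B v.
Proof. by rewrite /qform mulmxBr mulmxBl !mxE. Qed.

(** * Positive definite matrices *)

Lemma posdefmx_ge0 (R : realType) (n : nat) (A : 'M[R]_n) (v : 'cV[R]_n) :
  posdefmx A -> 0 <= qform A v.
Proof.
case=> _ pA; have [->|/pA/ltW//] := eqVneq v 0.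
by rewrite /qform mulmx0 mxE.
Qed.

Lemma posdefmx_unit (R : realType) (n : nat) (A : 'M[R]_n) :
  posdefmx A -> A \in unitmx.
Proof.
case=> _ pA; rewrite -row_free_unit -kermx_eq0; apply/rowV0P => u /sub_kermxP uA.
have [u0|uT0] := eqVneq u^T 0; first by rewrite -[u]trmxK u0 trmx0.
by have := pA _ uT0; rewrite /qform trmxK uA mul0mx mxE ltxx.
Qed.

Lemma posdefmx_congr (R : realType) (n k : nat) (A : 'M[R]_n) (P : 'M[R]_(n, k)) :
  posdefmx A -> (forall v : 'cV[R]_k, P *m v = 0 -> v = 0) ->
  posdefmx (P^T *m A *m P).
Proof.
move=> [sA pA] injP; split; first by rewrite !trmx_mul trmxK sA mulmxA.
move=> v v0; have: P *m v != 0 by apply: contra_neq v0; exact: injP.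
by move=> /pA; rewrite /qform trmx_mul !mulmxA.
Qed.

(** * Energy norm of a symmetric two-level iteration *)

(** In order 0 the supremum is over the empty set and equals 0, so the bound
    comes from [0 <= b] alone. *)
Lemma opnormA_le (R : realType) (n : nat) (A B : 'M[R]_n) (b : R) :
  posdefmx A -> 0 <= b ->
  (forall v, qform A (B *m v) <= b ^+ 2 * qform A v) -> opnormA A B <= b.
Proof.
move=> pA b0 hB; rewrite /opnormA; set E := (X in sup X).
have [->|/set0P E0] := eqVneq E set0; first by rewrite sup0.
apply: ge_sup => // _ [v /= v0 <-].
rewrite ler_pdivrMr ?normA_gt0// /normA.
rewrite -[b]ger0_norm// -sqrtr_sqr -sqrtrM ?sqr_ge0//.
by rewrite ler_wsqrtr// ger0_norm.
Qed.

Lemma projA_orth (R : realType) (n k : nat) (A : 'M[R]_n) (P : 'M[R]_(n, k)) :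
  P^T *m A *m P \in unitmx -> P^T *m A *m (1%:M - projA A P) = 0.
Proof.
move=> uP; rewrite mulmxBr mulmx1 /projA !mulmxA mulmxV// mul1mx.
by rewrite subrr.
Qed.

(** With [u = Q K v], the hypothesis and self-adjointness give
    |E v|^2 = |K u|^2 <= b |u|^2 = b <E v, v>.  Expanding |E v - b v|^2 >= 0
    then yields |E v|^2 <= b^2 |v|^2, so the Cauchy-Schwarz inequality is used
    only through a completed square. *)
Lemma symmetric_two_level_bound (R : realType) (n k : nat) (A K : 'M[R]_n)
    (P : 'M[R]_(n, k)) (b : R) :
  posdefmx A -> P^T *m A *m P \in unitmx ->
  (forall u v, dotmx A (K *m u) v = dotmx A u (K *m v)) -> 0 <= b ->
  (forall u, P^T *m A *m u = 0 -> qform A (K *m u) <= b * qform A u) ->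
  opnormA A (K *m (1%:M - projA A P) *m K) <= b.
Proof.
move=> pA uP adjK b0 hK; apply: opnormA_le => // v; have sA := pA.1.
rewrite -!mulmxA; set u := (_ - _) *m (K *m v).
have orthu : P^T *m A *m u = 0 by rewrite mulmxA projA_orth// mul0mx.
(* <u, K v - u> vanishes because K v - u lies in the range of P *)
have uu : qform A u = dotmx A (K *m u) v.
  rewrite adjK qform_dotmx {2}/u mulmxBl mul1mx dotmxBr.
  rewrite [X in _ - X](_ : _ = 0) ?subr0// dotmxC// /dotmx /projA.
  by rewrite !trmx_mul !trmxK sA -!mulmxA (mulmxA P^T A u) orthu !mulmx0 mxE.
have := posdefmx_ge0 (K *m u - b *: v) pA.
have := hK u orthu.
rewrite qformB// dotmxZr qformZ uu; lra.
Qed.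

(** * Decay of a self-adjoint iteration *)

(** The chord bound x^(2 nu) <= 1 - c (1 - x) on [mu, 1], with
    c = (1 - mu^(2 nu)) / (1 - mu), for an operator [G] between [mu] and 1.
    Induction on [nu] replaces the spectral theorem: the step from [nu] to
    [nu + 1] asks for nonnegativity of
      (1 - x) (x - mu) (1 + 2 mu c) + c (1 - x) (x - mu)^2
    at [G].  The second term is a square weighted by [1 - G].  In the first,
    1 + 2 mu c >= 0 and (1 - x) (x - mu) times (1 - mu) is
    (1 - x)^2 (x - mu) + (1 - x) (x - mu)^2, a sum of squares weighted by
    [G - mu] and [1 - G]. *)
Lemma geometric_decay (R : realType) (n nu : nat) (A G : 'M[R]_n) (mu : R) :
  (forall u v, dotmx A (G *m u) v = dotmx A u (G *m v)) ->
  -1 <= mu -> mu < 1 ->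
  (forall v, dotmx A v (G *m v) <= qform A v) ->
  (forall v, mu * qform A v <= dotmx A v (G *m v)) ->
  forall v, qform A (G ^+ nu *m v) <=
    qform A v - (1 - mu ^+ (2 * nu)) / (1 - mu) * (qform A v - dotmx A v (G *m v)).
Proof.
move=> adjG mu1 mu2 hG1 hGmu.
have mu0 : 0 < 1 - mu by lra.
elim: nu => [|nu IH] v.
  by rewrite expr0 -[1]/(1%:M) mul1mx muln0 expr0 subrr !mul0r subr0.
rewrite exprSr -mulmxA.
apply: (le_trans (IH _)).
have mn : 0 <= mu ^+ (2 * nu) <= 1.
  rewrite exprM exprn_ge0 ?sqr_ge0//= exprn_ile1 ?sqr_ge0//.
  nra.
set c := (1 - mu ^+ (2 * nu)) / (1 - mu).
have cE : c * (1 - mu) = 1 - mu ^+ (2 * nu) by rewrite /c divfK// gt_eqF.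
have c0 : 0 <= c by rewrite /c divr_ge0 ?(ltW mu0)//; lra.
have -> : (1 - mu ^+ (2 * nu.+1)) / (1 - mu) = 1 + mu + mu ^+ 2 * c.
  rewrite mulnS exprD -[in LHS](subKr 1 (mu ^+ (2 * nu))) -cE; field.
  by rewrite gt_eqF.
(* for mu < 0, c <= 1 / (1 - mu), so this is at least (1 + mu) / (1 - mu) *)
have a0 : 0 <= 1 + 2 * mu * c by nra.
(* 1 - G is tested at (G - mu) v and G - mu at (1 - G) v; by self-adjointness
   everything is linear in the moments m_k = <v, G^k v> *)
have := hG1 (G *m v - mu *: v).
have := hGmu (v - G *m v).
rewrite !qform_dotmx !mulmxBr -!scalemxAr !(dotmxBl, dotmxBr, dotmxZl, dotmxZr).
rewrite !adjG -!qform_dotmx.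
set m0 := qform A v; set m1 := dotmx A v (G *m v).
set m2 := dotmx A v (G *m (G *m v)).
set m3 := dotmx A v (G *m (G *m (G *m v))).
move=> h1 h2.
have h3 : 0 <= (1 - mu) * (- mu * m0 + (1 + mu) * m1 - m2) by nra.
(* (1 - G) (G - mu) is nonnegative at v *)
have h4 : 0 <= - mu * m0 + (1 + mu) * m1 - m2 by rewrite pmulr_rge0 in h3.
have := mulr_ge0 a0 h4.
(* (1 - G) (G - mu)^2 is nonnegative at v *)
have h5 : 0 <= (m2 - 2 * mu * m1 + mu ^+ 2 * m0) - (m3 - 2 * mu * m2 + mu ^+ 2 * m1).
  lra.
have := mulr_ge0 c0 h5.
lra.
Qed.

(** * Two comparison estimates *)

(** Formally x = N^-1 A v, and the claim is A <= A N^-1 A, the consequence of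
    N <= A.  Stating it with [N x = A v] allows a singular [N]; the proof
    expands <N (v - x), v - x> >= 0. *)
Lemma qform_le_of_minorant (R : realType) (n : nat) (A N : 'M[R]_n)
    (v x : 'cV[R]_n) :
  A^T = A -> loewner_ge A N -> loewner_ge N 0 -> N *m x = A *m v ->
  qform A v <= dotmx A v x.
Proof.
move=> sA [_ AN] []; rewrite subr0 => sN N0 Nx.
have NAv u : dotmx N u x = dotmx A u v by rewrite /dotmx -!mulmxA Nx.
have := N0 (v - x); have := AN v.
rewrite qformB// !NAv [qform N x]NAv (dotmxC x v sA).
rewrite qformBmx -qform_dotmx; lra.
Qed.

(** If x = B v depends linearly on [v] and B is self-adjoint for [A], this
    says that B^2 <= a B implies B <= a.  The square completed is
    |a v - x|^2 >= 0. *)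
Lemma dotmx_le_of_upper_bound (R : realType) (n : nat) (A : 'M[R]_n)
    (v x : 'cV[R]_n) (a : R) :
  posdefmx A -> 0 < a -> qform A x <= a * dotmx A v x ->
  dotmx A v x <= a * qform A v.
Proof.
move=> pA a0 hx.
have := posdefmx_ge0 (a *: v - x) pA.
rewrite qformB ?pA.1// dotmxZl qformZ => h.
have: 0 <= a * (a * qform A v - dotmx A v x) by lra.
by rewrite pmulr_rge0// subr_ge0.
Qed.

(** * The bounds as functions of the relaxation parameter *)

Lemma bound2E (R : realType) (eps omega : R) (nu : nat) : 0 < eps ->
  bound2 eps nu omega =
  eps / (1 + eps) + (1 - omega^-1 * (1 + eps)) ^+ (2 * nu) / (1 + eps).
Proof. by move=> e0; rewrite /bound2; field; apply/eqP; lra. Qed.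

Lemma bound1E (R : realType) (eps omega : R) : 0 < eps -> omega != 0 ->
  bound1 eps omega = bound2 eps 1 omega.
Proof.
move=> e0 w0; rewrite /bound1 /bound2 muln1; field.
by rewrite w0 andbT; apply/eqP; lra.
Qed.

Lemma eq_attains_min (R : realType) (f g : R -> R) (D : set R) (m x : R) :
  (forall y, D y -> f y = g y) -> attains_min f D m x -> attains_min g D m x.
Proof.
move=> fg [Dx fx fm]; split=> // [|y Dy]; first by rewrite -fg.
by rewrite -fg//; exact: fm.
Qed.

Lemma bound2_attains_min (R : realType) (eps omega : R) (nu : nat) :
  0 < eps -> (1 <= nu)%N -> (1 + eps) / 2 < omega ->
  attains_min (bound2 eps nu) [set w | (1 + eps) / 2 < w] (eps / (1 + eps)) omega
  <-> omega = 1 + eps.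
Proof.
move=> e0 nu0 hw; have w0 : omega != 0 by apply/eqP; lra.
have e1 : 1 + eps != 0 by apply/eqP; lra.
split=> [[_ + _]|->].
  rewrite bound2E// => /eqP; rewrite -subr_eq0 addrC addKr.
  rewrite mulf_eq0 invr_eq0 (negbTE e1) orbF expf_eq0 muln_gt0 nu0 /=.
  rewrite subr_eq0 => /eqP/(congr1 ( *%R omega)).
  by rewrite mulr1 mulVKf.
split=> /=; first lra.
  by rewrite bound2E// mulVf// subrr expr0n muln_eq0 (gtn_eqF nu0) /= mul0r addr0.
move=> y _; rewrite bound2E// lerDl divr_ge0//; last lra.
by rewrite exprM exprn_ge0// sqr_ge0.
Qed.


(** * The two-level method with block smoothing *)

Lemma two_level_bound (R : realType) (nf nc nu : nat)
    (A : 'M[R]_(nf + nc)) (Aff Dff : 'M[R]_nf) (Afc : 'M[R]_(nf, nc))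
    (Acf : 'M[R]_(nc, nf)) (Acc : 'M[R]_nc) (eps omega : R)
    (S := col_mx 1%:M 0 : 'M[R]_(nf + nc, nf))
    (P := col_mx (- (invmx Dff *m Afc)) 1%:M : 'M[R]_(nf + nc, nc)) :
  posdefmx A -> A = block_mx Aff Afc Acf Acc -> Acf = Afc^T ->
  0 < eps -> posdefmx Dff -> loewner_ge Aff Dff ->
  loewner_ge Dff ((1 + eps)^-1 *: Aff) ->
  loewner_ge (block_mx Dff Afc Acf Acc) 0 -> (1 + eps) / 2 < omega ->
  opnormA A (ETL A S (omega *: Dff) P nu) <= bound2 eps nu omega.
Proof.
move=> pA AE AcfE e0 pD AD DA N0 hw.
have sA := pA.1; have uD := posdefmx_unit pD.
have w0 : 0 < omega by lra.
set N := block_mx _ _ _ _ in N0.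
(* S *m y v is the undamped smoothing correction B v *)
have SE w : S *m w = col_mx w 0 :> 'cV[R]__ by rewrite mul_col_mx mul1mx mul0mx.
pose y (v : 'cV[R]_(nf + nc)) := invmx Dff *m (S^T *m (A *m v)).
have DyE v : Dff *m y v = S^T *m (A *m v) by rewrite /y mulKVmx.
have invM : invmx (omega *: Dff) = omega^-1 *: invmx Dff.
  by rewrite invmxZ// unitmxZ// unitfE gt_eqF.
have symM : (invmx (omega *: Dff))^T = invmx (omega *: Dff).
  by rewrite trmx_inv linearZ /= pD.1.
rewrite /ETL symM; set G := 1%:M - _.
have GE v : G *m v = v - omega^-1 *: (S *m y v).
  by rewrite /G mulmxBl mul1mx invM -!(scalemxAr, scalemxAl) -!mulmxA.
have dotSE u v : dotmx A u (S *m y v) = dotmx Dff (y u) (y v).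
  have uAS : u^T *m A *m S = (y u)^T *m Dff.
    by rewrite -[RHS]trmxK trmx_mul trmxK pD.1 DyE !trmx_mul !trmxK sA.
  by rewrite /dotmx mulmxA uAS.
have dotG u v : dotmx A u (G *m v) = dotmx A u v - omega^-1 * dotmx Dff (y u) (y v).
  by rewrite GE dotmxBr dotmxZr dotSE.
have adjG u v : dotmx A (G *m u) v = dotmx A u (G *m v).
  by rewrite dotmxC// !dotG (dotmxC v u sA) (dotmxC (y v) (y u) pD.1).
have adjK k u v : dotmx A (G ^+ k *m u) v = dotmx A u (G ^+ k *m v).
  elim: k u v => [|k IH] u v; first by rewrite expr0 -[1]/(1%:M) !mul1mx.
  by rewrite {1}exprS exprSr -!mulmxA adjG IH.
(* |B v|^2 only sees the block Aff, which Dff controls up to 1 + eps *)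
have yub v : qform Dff (y v) <= (1 + eps) * qform A v.
  rewrite qform_dotmx -dotSE; apply: dotmx_le_of_upper_bound => //; first lra.
  rewrite dotSE -qform_dotmx.
  have -> : qform A (S *m y v) = qform Aff (y v).
    rewrite /qform AE SE tr_col_mx trmx0.
    by rewrite mul_row_block mul_row_col !mul0mx !mulmx0 !addr0.
  have := DA.2 (y v).
  rewrite qformBmx [qform (_ *: _) _]/qform -scalemxAr -scalemxAl mxE -/(qform _ _).
  by rewrite subr_ge0 mulrC ler_pdivrMr 1?mulrC//; lra.
(* P^T A v = 0 says that the coarse part of A v is Acf Dff^-1 (A v)_f, which
   means N (B v) = A v *)
have ylb v : P^T *m A *m v = 0 -> qform A v <= qform Dff (y v).
  move=> Pv; rewrite [qform Dff _]qform_dotmx -dotSE.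
  apply: (@qform_le_of_minorant _ _ _ N) => //.
    split=> [|u].
      by rewrite linearB /= sA; congr (_ - _); have := N0.1; rewrite subr0.
    rewrite -[u]vsubmxK AE /N opp_block_mx add_block_mx !subrr /qform tr_col_mx.
    rewrite mul_row_block mul_row_col !mulmx0 !addr0 mul0mx addr0.
    exact: AD.2.
  rewrite SE /N mul_block_col !mulmx0 !addr0 DyE.
  move: Pv; rewrite -mulmxA /y; set r := A *m v.
  rewrite -[r]vsubmxK /P /S !tr_col_mx !mul_row_col !trmx1 trmx0 mul0mx !mul1mx addr0.
  rewrite linearN /= trmx_mul trmx_inv pD.1 AcfE mulNmx mulmxA => /eqP.
  by rewrite addrC subr_eq0 => /eqP ->.
have yge0 v : 0 <= qform Dff (y v) by exact: posdefmx_ge0.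
have uP : P^T *m A *m P \in unitmx.
  apply: posdefmx_unit; apply: posdefmx_congr => // v.
  rewrite /P mul_col_mx mul1mx -col_mx0 => /eq_col_mx[].
  by [].
pose mu := 1 - omega^-1 * (1 + eps).
have t0 : 0 < omega^-1 by rewrite invr_gt0.
have tw : omega^-1 * omega = 1 by rewrite mulVf// gt_eqF.
have mu1 : -1 <= mu by rewrite /mu; nra.
have mu2 : mu < 1 by rewrite /mu; nra.
have mn : 0 <= mu ^+ (2 * nu) <= 1.
  rewrite exprM exprn_ge0 ?sqr_ge0//= exprn_ile1 ?sqr_ge0//; nra.
apply: symmetric_two_level_bound => //.
- rewrite bound2E// -mulrDl divr_ge0//; last lra.
  by rewrite -/mu; lra.
move=> u Pu; apply: (le_trans (geometric_decay nu adjG mu1 mu2 _ _ u)).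
- by move=> v; rewrite dotG -!qform_dotmx gerBl mulr_ge0// ltW.
- move=> v; rewrite dotG -!qform_dotmx /mu; have := yub v.
  rewrite -(ler_pM2l t0); lra.
rewrite dotG -!qform_dotmx.
have -> : bound2 eps nu omega = 1 - (1 - mu ^+ (2 * nu)) / (1 - mu) * omega^-1.
  rewrite /bound2 -/mu {2}/mu subKr; move: (mu ^+ _) => m; field.
  by rewrite (gt_eqF w0) /=; apply/eqP; lra.
set c := _ / (1 - mu); have c0 : 0 <= c by rewrite /c divr_ge0//; lra.
have d0 : 0 <= qform Dff (y u) - qform A u by rewrite subr_ge0 ylb.
have := mulr_ge0 (mulr_ge0 c0 (ltW t0)) d0; lra.
Qed.

Theorem theorem3p10 (R : realType) (nf nc : nat)
    (A : 'M[R]_(nf + nc)) (Aff : 'M[R]_nf) (Afc : 'M[R]_(nf, nc))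
    (Acf : 'M[R]_(nc, nf)) (Acc : 'M[R]_nc) (Dff : 'M[R]_nf) (eps : R)
    (hA : posdefmx A) (hblock : A = block_mx Aff Afc Acf Acc)
    (hAcf : Acf = Afc^T)
    (heps : 0 < eps) (hD : posdefmx Dff)
    (hAD : loewner_ge Aff Dff)
    (hDA : loewner_ge Dff ((1 + eps)^-1 *: Aff))
    (hDblock : loewner_ge (block_mx Dff Afc Acf Acc) 0) :
  let S : 'M[R]_(nf + nc, nf) := col_mx 1%:M 0 in
  let P : 'M[R]_(nf + nc, nc) := col_mx (- (invmx Dff *m Afc)) 1%:M in
  let dom : set R := [set omega | (1 + eps) / 2 < omega] in
  [/\ forall omega, dom omega ->
        opnormA A (ETL A S (omega *: Dff) P 1) <= bound1 eps omega,
      forall omega nu, dom omega -> (1 <= nu)%N ->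
        opnormA A (ETL A S (omega *: Dff) P nu) <= bound2 eps nu omega,
      forall omega, dom omega ->
        (attains_min (bound1 eps) dom (eps / (1 + eps)) omega
           <-> omega = 1 + eps) &
      forall nu omega, (1 <= nu)%N -> dom omega ->
        (attains_min (bound2 eps nu) dom (eps / (1 + eps)) omega
           <-> omega = 1 + eps)].
Proof.
move=> S P dom.
have bd nu omega : dom omega ->
    opnormA A (ETL A S (omega *: Dff) P nu) <= bound2 eps nu omega.
  exact: two_level_bound hA hblock hAcf heps hD hAD hDA hDblock.
have b1E y : dom y -> bound1 eps y = bound2 eps 1 y.
  by rewrite /dom /= => hy; apply: bound1E => //; apply/eqP; lra.
split.
- by move=> omega hw; rewrite b1E//; exact: bd.
- by move=> omega nu hw _; exact: bd.
- move=> omega hw; rewrite -(bound2_attains_min heps (leqnn 1) hw).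
  by split; apply: eq_attains_min => y hy; rewrite b1E.
- by move=> nu omega nu1 hw; exact: bound2_attains_min.
Qed.
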